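(* Let $V$ be an admissible $(\mathfrak g,K)$-module and let $v\in V$ be a $K$-highest weight vector of weight $(n,k,m)$. Then the following four identities hold when both sides are applied to $v$ (the scalars on the right-hand sides being understood as multiples of the identity): $$\tfrac1{(n+2)(m+2)}A_\beta B_\beta-\tfrac1{(n+1)(m+1)}B_\beta A_\beta-\tfrac1{(n+1)(n+2)(m+1)}B_{\alpha+\beta}A_{\alpha+\beta}-\tfrac1{(n+1)(m+1)(m+2)}B_{\beta+\gamma}A_{\beta+\gamma}-\tfrac1{(n+1)(n+2)(m+1)(m+2)}B_{\alpha+\beta+\gamma}A_{\alpha+\beta+\gamma}=\tfrac12(k-n-m),$$ $$\tfrac1{(n+1)(m+2)}A_{\alpha+\beta}B_{\alpha+\beta}-\tfrac1{(n+2)(m+1)}B_{\alpha+\beta}A_{\alpha+\beta}+\tfrac1{(n+1)(n+2)(m+2)}A_\beta B_\beta-\tfrac1{(n+2)(m+1)(m+2)}B_{\alpha+\beta+\gamma}A_{\alpha+\beta+\gamma}=\tfrac12(k+n-m),$$ $$\tfrac1{(n+2)(m+1)}A_{\beta+\gamma}B_{\beta+\gamma}-\tfrac1{(n+1)(m+2)}B_{\beta+\gamma}A_{\beta+\gamma}+\tfrac1{(n+2)(m+1)(m+2)}A_\beta B_\beta-\tfrac1{(n+1)(n+2)(m+2)}B_{\alpha+\beta+\gamma}A_{\alpha+\beta+\gamma}=\tfrac12(k-n+m),$$ $$\tfrac1{(n+1)(m+1)}A_{\alpha+\beta+\gamma}B_{\alpha+\beta+\gamma}-\tfrac1{(n+2)(m+2)}B_{\alpha+\beta+\gamma}A_{\alpha+\beta+\gamma}+\tfrac1{(n+1)(m+1)(m+2)}A_{\alpha+\beta}B_{\alpha+\beta}+\tfrac1{(n+1)(n+2)(m+1)}A_{\beta+\gamma}B_{\beta+\gamma}+\tfrac1{(n+1)(n+2)(m+1)(m+2)}A_\beta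 B_\beta=\tfrac12(k+n+m).$$
   Context: Let $\mathfrak g=\mathfrak{sl}(4,\mathbb C)$ with matrix units $E_{ij}$, and let $K=S(U(2)\times U(2))$ (block diagonal) be the maximal compact subgroup of $SU(2,2)$. Put $H_\alpha=E_{11}-E_{22}$, $H_\beta=E_{22}-E_{33}$, $H_\gamma=E_{33}-E_{44}$; $X_\alpha=E_{12}$, $X_\beta=E_{23}$, $X_\gamma=E_{34}$, $X_{\alpha+\beta}=E_{13}$, $X_{\beta+\gamma}=E_{24}$, $X_{\alpha+\beta+\gamma}=E_{14}$; and $Y_\delta=X_\delta^{t}$ (transpose) for each positive root $\delta$. Put $H_0=H_\alpha+2H_\beta+H_\gamma$. $V$ is an admissible $(\mathfrak g,K)$-module. A $K$-highest weight vector of weight $(n,k,m)$ ($n,m\in\mathbb Z_{\ge0}$, $k\in\mathbb Z$) is $v\in V$ with $X_\alpha v=X_\gamma v=0$, $H_\alpha v=nv$, $H_\gamma v=mv$, $H_0v=kv$ (so $H_\beta v=\tfrac12(k-n-m)v$). The following operators map the span of $K$-highest weight vectors to itself (products are compositions, the rightmost factor acting first): $A_{\alpha+\beta+\gamma}=X_{\alpha+\beta+\gamma}$; $A_{\alpha+\beta}=X_{\alpha+\beta}(H_\gamma+1)+Y_\gamma X_{\alpha+\beta+\gamma}$; $A_{\beta+\gamma}=X_{\beta+\gamma}(H_\alpha+1)-Y_\alpha X_{\alpha+\beta+\gamma}$; $A_\beta=X_\beta(H_\alpha+1)(H_\gamma+1)-Y_\alpha X_{\alpha+\beta}(H_\gamma+1)+Y_\gamma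 X_{\beta+\gamma}(H_\alpha+1)-Y_\alpha Y_\gamma X_{\alpha+\beta+\gamma}$; $B_{\alpha+\beta+\gamma}=Y_{\alpha+\beta+\gamma}(H_\alpha+1)(H_\gamma+1)+Y_\alpha Y_{\beta+\gamma}(H_\gamma+1)-Y_\gamma Y_{\alpha+\beta}(H_\alpha+1)-Y_\alpha Y_\gamma Y_\beta$; $B_{\alpha+\beta}=Y_{\alpha+\beta}(H_\alpha+1)+Y_\alpha Y_\beta$; $B_{\beta+\gamma}=Y_{\beta+\gamma}(H_\gamma+1)-Y_\gamma Y_\beta$; $B_\beta=Y_\beta$. *)

(* Defs.v *)
From HB Require Import structures.
From mathcomp Require Import all_boot all_order all_algebra.
From mathcomp Require Import spectral sesquilinear.
From mathcomp Require Import complex.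
From mathcomp Require Import all_classical all_reals all_analysis.

Set Implicit Arguments.
Unset Strict Implicit.
Unset Printing Implicit Defensive.

Import Order.TTheory GRing.Theory Num.Theory.
Import numFieldNormedType.Exports.

Local Open Scope classical_set_scope.
Local Open Scope complex_scope.
Local Open Scope ring_scope.
Local Open Scope sesquilinear_scope.

(* [R[i]] recast as a [numClosedFieldType], so that it inherits the topology
   that MathComp-Analysis puts on every [numFieldType]. *)
Definition C (R : realType) : numClosedFieldType := R[i].

Section Groups.
Context (R : realType).
Implicit Types X k : 'M[C R]_4.

Definition sl4 : set 'M[C R]_4 := [set X | \tr X = 0].

(* K = S(U(2) x U(2)) *)
Definition K : set 'M[C R]_4 :=
  [set k | exists a d : 'M[C R]_2,
    [/\ a \is unitarymx, d \is unitarymx,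
        k = block_mx a 0 0 d & \det k = 1]].

(* The real Lie algebra of K. *)
Definition LieK : set 'M[C R]_4 :=
  [set X | exists a d : 'M[C R]_2,
    [/\ a^t* = - a, d^t* = - d, X = block_mx a 0 0 d & \tr X = 0]].

(* The series converges for every X, so [limn] is the matrix exponential. *)
Definition expmx X : 'M[C R]_4 :=
  limn (series (fun j : nat => (j`!%:R : C R)^-1 *: X ^+ j)).

End Groups.

Section GKModules.
Context (R : realType) (V : lmodType (C R)).

Definition lincomb d (w : 'I_d -> V) (a : 'cV[C R]_d) : V :=
  \sum_(i < d) a i 0 *: w i.

Definition independent d (w : 'I_d -> V) : Prop :=
  forall a, lincomb w a = 0 -> a = 0.

(* V carries no topology: a curve in V has derivative u at 0 if it lies in a
   finite-dimensional subspace and has derivative u there, in coordinates. *)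
Definition has_derivative_at0 (f : R -> V) (u : V) : Prop :=
  exists (d : nat) (w : 'I_d -> V) (c : R -> 'cV[C R]_d) (b : 'cV[C R]_d),
    [/\ independent w,
        forall t, f t = lincomb w (c t),
        u = lincomb w b &
        (fun t : R => (t%:C : C R)^-1 *: (c t - c 0)) @ 0^' --> b].

Implicit Type act : 'M[C R]_4 -> {linear V -> V}.
Implicit Type rho : 'M[C R]_4 -> {linear V -> V}.

(* A representation of a Lie algebra or group is a function on all 4 x 4
   matrices; only its values on [sl4], respectively on [K], are used. *)

Definition lie_representation rho : Prop :=
  (forall (a : C R) (X Y : 'M[C R]_4) (v : V), sl4 X -> sl4 Y ->
     rho (a *: X + Y) v = a *: rho X v + rho Y v) /\
  (forall (X Y : 'M[C R]_4) (v : V), sl4 X -> sl4 Y ->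
     rho (X *m Y - Y *m X) v = rho X (rho Y v) - rho Y (rho X v)).

Definition group_representation act : Prop :=
  (forall v, act 1%:M v = v) /\
  (forall k l v, K k -> K l -> act (k *m l) v = act k (act l v)).

(* Every vector lies in a finite-dimensional K-stable subspace on which K acts
   continuously; tau is the matrix of the action in the basis w. *)
Definition locally_K_finite act : Prop :=
  forall v : V, exists (d : nat) (w : 'I_d -> V) (a : 'cV[C R]_d)
                       (tau : 'M[C R]_4 -> 'M[C R]_d),
    [/\ independent w,
        v = lincomb w a,
        forall k (x : 'cV[C R]_d), K k ->
          act k (lincomb w x) = lincomb w (tau k *m x) &
        {within @K R, continuous tau}].

Record is_gK_module rho act : Prop := {
  gK_lie : lie_representation rho;
  gK_group : group_representation act;
  gK_finite : locally_K_finite act;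
  gK_differential : forall (X : 'M[C R]_4) (v : V), LieK X ->
    has_derivative_at0 (fun t : R => act (expmx ((t%:C : C R) *: X)) v)
                       (rho X v);
  gK_compatible : forall (k X : 'M[C R]_4) (v : V), K k -> sl4 X ->
    act k (rho X v) = rho (k *m X *m invmx k) (act k v)
}.

Record K_irrep d (tau : 'M[C R]_4 -> 'M[C R]_d) : Prop := {
  irrep_dim : (0 < d)%N;
  irrep_1 : tau 1%:M = 1%:M;
  irrep_M : forall k l, K k -> K l -> tau (k *m l) = tau k *m tau l;
  irrep_cont : {within @K R, continuous tau};
  irrep_irr : forall U : {vspace 'cV[C R]_d},
    (forall k x, K k -> x \in U -> tau k *m x \in U) -> U = 0%VS \/ U = fullv
}.

Definition K_hom act d (tau : 'M[C R]_4 -> 'M[C R]_d)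
    (f : {linear 'cV[C R]_d -> V}) : Prop :=
  forall k x, K k -> f (tau k *m x) = act k (f x).

(* Hom_K(tau, V) is finite-dimensional for every irreducible tau. *)
Definition admissible act : Prop :=
  forall d (tau : 'M[C R]_4 -> 'M[C R]_d), K_irrep tau ->
    exists (N : nat) (f : 'I_N -> {linear 'cV[C R]_d -> V}),
      (forall i, K_hom act tau (f i)) /\
      (forall g : {linear 'cV[C R]_d -> V}, K_hom act tau g ->
         exists c : 'I_N -> C R, forall x, g x = \sum_(i < N) c i *: f i x).

End GKModules.

Section Elements.
Context (R : realType).

(* Matrix units, with rows and columns numbered from 1 to 4. *)
Definition E (i j : nat) : 'M[C R]_4 := delta_mx (inord i.-1) (inord j.-1).

Definition H_a : 'M[C R]_4 := E 1 1 - E 2 2.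
Definition H_b : 'M[C R]_4 := E 2 2 - E 3 3.
Definition H_g : 'M[C R]_4 := E 3 3 - E 4 4.
Definition H_0 : 'M[C R]_4 := H_a + 2%:R *: H_b + H_g.

Definition X_a : 'M[C R]_4 := E 1 2.
Definition X_b : 'M[C R]_4 := E 2 3.
Definition X_g : 'M[C R]_4 := E 3 4.
Definition X_ab : 'M[C R]_4 := E 1 3.
Definition X_bg : 'M[C R]_4 := E 2 4.
Definition X_abg : 'M[C R]_4 := E 1 4.

Definition Y_a : 'M[C R]_4 := X_a^T.
Definition Y_b : 'M[C R]_4 := X_b^T.
Definition Y_g : 'M[C R]_4 := X_g^T.
Definition Y_ab : 'M[C R]_4 := X_ab^T.
Definition Y_bg : 'M[C R]_4 := X_bg^T.
Definition Y_abg : 'M[C R]_4 := X_abg^T.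

End Elements.

Section Operators.
Context (R : realType) (V : lmodType (C R)).
Variable rho : 'M[C R]_4 -> {linear V -> V}.

Record K_highest_weight (n : nat) (k : int) (m : nat) (v : V) : Prop := {
  hw_X_a : rho (X_a R) v = 0;
  hw_X_g : rho (X_g R) v = 0;
  hw_H_a : rho (H_a R) v = n%:R *: v;
  hw_H_g : rho (H_g R) v = m%:R *: v;
  hw_H_0 : rho (H_0 R) v = k%:~R *: v
}.

Definition Ha1 : V -> V := rho (H_a R) \+ idfun.
Definition Hg1 : V -> V := rho (H_g R) \+ idfun.

Definition A_abg : V -> V := rho (X_abg R).

Definition A_ab : V -> V :=
  (rho (X_ab R) \o Hg1) \+ (rho (Y_g R) \o rho (X_abg R)).

Definition A_bg : V -> V :=
  (rho (X_bg R) \o Ha1) \- (rho (Y_a R) \o rho (X_abg R)).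

Definition A_b : V -> V :=
  (rho (X_b R) \o Ha1 \o Hg1) \- (rho (Y_a R) \o rho (X_ab R) \o Hg1)
  \+ (rho (Y_g R) \o rho (X_bg R) \o Ha1)
  \- (rho (Y_a R) \o rho (Y_g R) \o rho (X_abg R)).

Definition B_abg : V -> V :=
  (rho (Y_abg R) \o Ha1 \o Hg1) \+ (rho (Y_a R) \o rho (Y_bg R) \o Hg1)
  \- (rho (Y_g R) \o rho (Y_ab R) \o Ha1)
  \- (rho (Y_a R) \o rho (Y_g R) \o rho (Y_b R)).

Definition B_ab : V -> V :=
  (rho (Y_ab R) \o Ha1) \+ (rho (Y_a R) \o rho (Y_b R)).

Definition B_bg : V -> V :=
  (rho (Y_bg R) \o Hg1) \- (rho (Y_g R) \o rho (Y_b R)).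

Definition B_b : V -> V := rho (Y_b R).

End Operators.

(* Main.v *)
Require Import Defs.
From HB Require Import structures.
From mathcomp Require Import all_boot all_order all_algebra.
From mathcomp Require Import complex.
From mathcomp Require Import all_classical all_reals all_analysis.
From mathcomp Require Import ring.

Import Order.TTheory GRing.Theory Num.Theory.
Local Open Scope ring_scope.

(** The identities are formal consequences of the bracket relations of sl(4)
and of the highest weight conditions on [v].

Each operator A_delta or B_delta shifts the eigenvalues of [H_a] and [H_g], so
on the vectors at hand the factors [H_a + 1] and [H_g + 1] occurring in them
are scalars ([A_bE] and its analogues). Every product
[A_delta (B_delta v)] or [B_delta (A_delta v)] thereby becomes a linear
combination of words in the root vectors E_ij, i != j, applied to [v].

As in the proof of the Poincare-Birkhoff-Witt theorem, commuting adjacent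
letters brings each word into the order Y_a, Y_g, then the noncompact negative
root vectors, then the noncompact positive ones, then X_a, X_g. The words
ending in X_a or X_g kill [v], and a bracket of opposite roots is a Cartan
element, which acts on [v] by one of the scalars c, c + n, c + m, c + n + m,
where c = (k - n - m) / 2. Both sides of each identity are then combinations
of the same ordered words, and the coefficients agree as rational functions of
n, m and c ([weight_vector_identities]). *)

(** * Comparing linear combinations *)

Section LinearExpressions.
Context {F : fieldType} {V : lmodType F}.

(** Formal linear combinations of vectors numbered by natural numbers. *)
Inductive lexpr : Type :=
| LVar of nat
| LZero
| LAdd of lexpr & lexpr
| LOpp of lexpr
| LScale of F & lexpr.

(** The value of an expression, its [i]-th variable standing for the [i]-th
entry of [s], or for 0 beyond the end of [s]. *)
Fixpoint leval (s : seq V) (x : lexpr) : V :=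
  match x with
  | LVar i => nth 0 s i
  | LZero => 0
  | LAdd y z => leval s y + leval s z
  | LOpp y => - leval s y
  | LScale c y => c *: leval s y
  end.

(** The total coefficient of the [i]-th variable. *)
Fixpoint lcoef (x : lexpr) (i : nat) : F :=
  match x with
  | LVar j => if i == j then 1 else 0
  | LZero => 0
  | LAdd y z => lcoef y i + lcoef z i
  | LOpp y => - lcoef y i
  | LScale c y => c * lcoef y i
  end.

(** Equality of the first [d] coefficients, as a conjunction that unfolds by
computation. *)
Fixpoint lcoef_eq (d : nat) (x y : lexpr) : Prop :=
  match d with
  | 0%N => True
  | d'.+1 => lcoef x d' = lcoef y d' /\ lcoef_eq d' x y
  end.

Lemma levalE s x : leval s x = \sum_(i < size s) lcoef x i *: s`_i.
Proof.
elim: x => [j||y IHy z IHz|y IHy|c y IHy] /=.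
- have [lt_js|le_sj] := ltnP j (size s).
    rewrite (bigD1 (Ordinal lt_js)) //= eqxx scale1r big1 ?addr0 // => i.
    by rewrite -val_eqE => /negPf /= ->; rewrite scale0r.
  rewrite nth_default // big1 // => i _; case: eqP => [eq_ij|_].
    by move: (ltn_ord i); rewrite eq_ij ltnNge le_sj.
  exact: scale0r.
- by rewrite big1 // => i _; rewrite scale0r.
- by rewrite IHy IHz -big_split; apply: eq_bigr => i _; rewrite scalerDl.
- by rewrite IHy -sumrN; apply: eq_bigr => i _; rewrite scaleNr.
- by rewrite IHy scaler_sumr; apply: eq_bigr => i _; rewrite scalerA.
Qed.

Lemma lcoef_eqP d x y :
  lcoef_eq d x y -> forall i, (i < d)%N -> lcoef x i = lcoef y i.
Proof.
elim: d => [//|d IHd] /= [eq_d /IHd lt_d] i; rewrite ltnS leq_eqVlt.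
by case/predU1P=> [->|/lt_d].
Qed.

Lemma leval_eq s x y : lcoef_eq (size s) x y -> leval s x = leval s y.
Proof.
move=> /lcoef_eqP eq_xy; rewrite !levalE; apply: eq_bigr => i _.
by rewrite eq_xy.
Qed.

End LinearExpressions.

(* Reification: [latoms] collects the vectors that are not themselves sums,
   opposites, multiples or 0, and [lreify] replaces them by their index. *)
Ltac lindex t s :=
  lazymatch s with
  | t :: _ => constr:(O)
  | _ :: ?s' => let i := lindex t s' in constr:(S i)
  end.

Ltac latoms t s :=
  lazymatch t with
  | (?a + ?b)%R => let s' := latoms a s in latoms b s'
  | (- ?a)%R => latoms a s
  | (_ *: ?a)%R => latoms a s
  | 0%R => s
  | _ => lazymatch s with
         | context [t :: _] => s
         | _ => constr:(t :: s)
         end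
  end.

Ltac lreify F t s :=
  lazymatch t with
  | (?a + ?b)%R => let x := lreify F a s in let y := lreify F b s in
                   constr:(@LAdd F x y)
  | (- ?a)%R => let x := lreify F a s in constr:(@LOpp F x)
  | (?c *: ?a)%R => let x := lreify F a s in constr:(@LScale F c x)
  | 0%R => constr:(@LZero F)
  | _ => let i := lindex t s in constr:(@LVar F i)
  end.

(** Reduces an equation between linear combinations over [F] of vectors in [V]
to the equality of the coefficients of each vector. *)
Ltac compare_coefficients F V :=
  lazymatch goal with
  | |- ?l = ?r =>
    let s := latoms l (@nil V) in
    let s := latoms r s in
    let x := lreify F l s in
    let y := lreify F r s in
    change (leval s x = leval s y)
  end;
  apply: leval_eq; rewrite /=; repeat split.

(** * Words in the matrix units *)

Section MatrixUnits.
Context {F : fieldType} {V : lmodType F}.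
Context (e h : nat -> nat -> {linear V -> V}).
Implicit Types (i j k l : nat) (n m : F) (w : V).

(** The action on [w] of the commutator of E_ij and E_kl, for i != j and
k != l, when [e i j] is the action of E_ij and [h i j] that of E_ii - E_jj. *)
Definition bracket_op i j k l w : V :=
  match j == k, i == l with
  | true, true => h i j w
  | true, false => e i l w
  | false, true => - e k j w
  | false, false => 0
  end.

(** E_ij is a root vector of sl(4): the indices are distinct and in 1..4. *)
Definition root_index i j := [&& (0 < i <= 4)%N, (0 < j <= 4)%N & i != j].

(** The value of the root of E_kl on E_ii - E_jj. *)
Definition root_value i j k l : F :=
  (i == k)%:R - (i == l)%:R - (j == k)%:R + (j == l)%:R.

(** The maps [e i j] and [h i j] satisfy the commutation relations of sl(4)
between two root vectors, and between a Cartan element and a root vector. *)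
Record sl4_relations : Prop := {
  unit_bracket : forall i j k l w, root_index i j -> root_index k l ->
    e i j (e k l w) = e k l (e i j w) + bracket_op i j k l w;
  cartan_bracket : forall i j k l w, root_index i j -> root_index k l ->
    h i j (e k l w) = e k l (h i j w) + root_value i j k l *: e k l w
}.

(** The position of E_ij in ordered words: Y_a, Y_g, the other negative root
vectors, the noncompact positive ones, and finally X_a, X_g. The value at other
pairs of indices is irrelevant. *)
Definition pbw_rank i j : nat :=
  match i, j with
  | 2, 1 => 0
  | 4, 3 => 1
  | 1, (3 | 4) | 2, (3 | 4) => 3
  | 1, 2 | 3, 4 => 4
  | _, _ => 2
  end%N.

(* The linearity lemmas for [e] and [h] alone, so that rewriting with them does
   not look for other linear maps. *)
Lemma unitD i j x y : e i j (x + y) = e i j x + e i j y.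
Proof. exact: linearD. Qed.
Lemma unitN i j x : e i j (- x) = - e i j x.
Proof. exact: linearN. Qed.
Lemma unitZ i j c x : e i j (c *: x) = c *: e i j x.
Proof. exact: linearZ. Qed.
Lemma unit0 i j : e i j 0 = 0.
Proof. exact: linear0. Qed.

(** The operators A_delta and B_delta on vectors on which [H_a] acts by [n]
and [H_g] by [m]. *)
Definition wA_abg w : V := e 1 4 w.
Definition wA_ab m w : V := (m + 1) *: e 1 3 w + e 4 3 (e 1 4 w).
Definition wA_bg n w : V := (n + 1) *: e 2 4 w - e 2 1 (e 1 4 w).
Definition wA_b n m w : V :=
  ((n + 1) * (m + 1)) *: e 2 3 w - (m + 1) *: e 2 1 (e 1 3 w)
  + (n + 1) *: e 4 3 (e 2 4 w) - e 2 1 (e 4 3 (e 1 4 w)).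
Definition wB_abg n m w : V :=
  ((n + 1) * (m + 1)) *: e 4 1 w + (m + 1) *: e 2 1 (e 4 2 w)
  - (n + 1) *: e 4 3 (e 3 1 w) - e 2 1 (e 4 3 (e 3 2 w)).
Definition wB_ab n w : V := (n + 1) *: e 3 1 w + e 2 1 (e 3 2 w).
Definition wB_bg m w : V := (m + 1) *: e 4 2 w - e 4 3 (e 3 2 w).
Definition wB_b w : V := e 3 2 w.

End MatrixUnits.

Arguments unit_bracket {F V e h}.
Arguments cartan_bracket {F V e h}.

(** Rewrites every word in the maps [e i j] as a combination of ordered ones;
[rel : sl4_relations e h]. *)
Ltac normal_order e rel :=
  rewrite ?(unitD e, unitN e, unitZ e, unit0 e);
  repeat match goal with
  | |- context [GRing.Linear.sort (e ?i ?j)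
                  (GRing.Linear.sort (e ?k ?l) ?w)] =>
    lazymatch eval compute in (pbw_rank k l < pbw_rank i j)%N with
    | true => rewrite (unit_bracket rel i j k l w isT isT) /bracket_op /=
                ?(unitD e, unitN e, unitZ e, unit0 e)
    end
  end.

(** * The identities for a highest weight vector *)

Ltac unfold_operators :=
  rewrite /wA_abg /wA_ab /wA_bg /wA_b /wB_abg /wB_ab /wB_bg /wB_b.

(** Moves the maps [h i j] to the right in every word;
[rel : sl4_relations e h]. *)
Ltac cartan_right e h rel :=
  rewrite ?(unitD h, unitN h, unitZ h);
  repeat match goal with
  | |- context [GRing.Linear.sort (h ?i ?j)
                  (GRing.Linear.sort (e ?k ?l) ?w)] =>
    rewrite (cartan_bracket rel i j k l w isT isT) /root_value /=
      ?(unitD e, unitN e, unitZ e)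
  end.

Section WeightVectors.
Context {F : fieldType} {V : lmodType F}.
Context {e h : nat -> nat -> {linear V -> V}} (rel : sl4_relations e h).
Context {n m : F} {v : V} (hn : h 1 2 v = n *: v) (hm : h 3 4 v = m *: v).

Ltac eigenvector :=
  unfold_operators; cartan_right e h rel; rewrite ?hn ?hm ?(unitZ e);
  compare_coefficients F V; ring.

(** The operators shift eigenvalues; only the eigenvalues that enter a second
operator applied to the result are recorded. *)
Lemma wA_ab_weight : h 1 2 (wA_ab e m v) = (n + 1) *: wA_ab e m v.
Proof. eigenvector. Qed.

Lemma wA_bg_weight : h 3 4 (wA_bg e n v) = (m + 1) *: wA_bg e n v.
Proof. eigenvector. Qed.

Lemma wA_abg_weight : h 1 2 (wA_abg e v) = (n + 1) *: wA_abg e v /\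
                      h 3 4 (wA_abg e v) = (m + 1) *: wA_abg e v.
Proof. by split; eigenvector. Qed.

Lemma wB_b_weight : h 1 2 (wB_b e v) = (n + 1) *: wB_b e v /\
                    h 3 4 (wB_b e v) = (m + 1) *: wB_b e v.
Proof. by split; eigenvector. Qed.

Lemma wB_ab_weight : h 3 4 (wB_ab e n v) = (m + 1) *: wB_ab e n v.
Proof. eigenvector. Qed.

Lemma wB_bg_weight : h 1 2 (wB_bg e m v) = (n + 1) *: wB_bg e m v.
Proof. eigenvector. Qed.

Context {c : F} (hXa : e 1 2 v = 0) (hXg : e 3 4 v = 0).
Context (h23 : h 2 3 v = c *: v) (h13 : h 1 3 v = (c + n) *: v).
Context (h24 : h 2 4 v = (c + m) *: v) (h14 : h 1 4 v = (c + n + m) *: v).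
Context (n1 : n + 1 != 0) (n2 : n + 2 != 0).
Context (m1 : m + 1 != 0) (m2 : m + 2 != 0).

(** The four identities over an arbitrary field, for a highest weight vector on
which [H_b] acts by [c] and no denominator vanishes. The parameters of the
outer operator in each product are the eigenvalues on the image of the inner
one. *)
Lemma weight_vector_identities :
  [/\ (1 / ((n + 2) * (m + 2))) *: wA_b e (n + 1) (m + 1) (wB_b e v)
      - (1 / ((n + 1) * (m + 1))) *: wB_b e (wA_b e n m v)
      - (1 / ((n + 1) * (n + 2) * (m + 1))) *: wB_ab e (n + 1) (wA_ab e m v)
      - (1 / ((n + 1) * (m + 1) * (m + 2))) *: wB_bg e (m + 1) (wA_bg e n v)
      - (1 / ((n + 1) * (n + 2) * (m + 1) * (m + 2)))
        *: wB_abg e (n + 1) (m + 1) (wA_abg e v)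
      = c *: v,
      (1 / ((n + 1) * (m + 2))) *: wA_ab e (m + 1) (wB_ab e n v)
      - (1 / ((n + 2) * (m + 1))) *: wB_ab e (n + 1) (wA_ab e m v)
      + (1 / ((n + 1) * (n + 2) * (m + 2)))
        *: wA_b e (n + 1) (m + 1) (wB_b e v)
      - (1 / ((n + 2) * (m + 1) * (m + 2)))
        *: wB_abg e (n + 1) (m + 1) (wA_abg e v)
      = (c + n) *: v,
      (1 / ((n + 2) * (m + 1))) *: wA_bg e (n + 1) (wB_bg e m v)
      - (1 / ((n + 1) * (m + 2))) *: wB_bg e (m + 1) (wA_bg e n v)
      + (1 / ((n + 2) * (m + 1) * (m + 2)))
        *: wA_b e (n + 1) (m + 1) (wB_b e v)
      - (1 / ((n + 1) * (n + 2) * (m + 2)))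
        *: wB_abg e (n + 1) (m + 1) (wA_abg e v)
      = (c + m) *: v
    & (1 / ((n + 1) * (m + 1))) *: wA_abg e (wB_abg e n m v)
      - (1 / ((n + 2) * (m + 2))) *: wB_abg e (n + 1) (m + 1) (wA_abg e v)
      + (1 / ((n + 1) * (m + 1) * (m + 2))) *: wA_ab e (m + 1) (wB_ab e n v)
      + (1 / ((n + 1) * (n + 2) * (m + 1))) *: wA_bg e (n + 1) (wB_bg e m v)
      + (1 / ((n + 1) * (n + 2) * (m + 1) * (m + 2)))
        *: wA_b e (n + 1) (m + 1) (wB_b e v)
      = (c + n + m) *: v ].
Proof.
split; unfold_operators; normal_order e rel;
  rewrite ?(h23, h13, h24, h14, hXa, hXg, unit0 e);
  compare_coefficients F V; field; by rewrite ?n1 ?n2 ?m1 ?m2.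
Qed.

End WeightVectors.

(** * The action of sl(4) on the module *)

Section Representation.
Context {R : realType}.
Implicit Types i j k l : nat.

Lemma mul_E i j k l : (0 < j <= 4)%N -> (0 < k <= 4)%N ->
  E R i j *m E R k l = if j == k then E R i l else 0.
Proof.
case: j k => [//|j] [//|k] /= lt_j lt_k.
by rewrite mul_delta_mx_cond -val_eqE /= !inordK // eqSS; case: eqP.
Qed.

Lemma trace_E i j : (0 < i <= 4)%N -> (0 < j <= 4)%N ->
  \tr (E R i j) = (i == j)%:R.
Proof.
case: i j => [//|i] [//|j] /= lt_i lt_j.
rewrite /mxtrace (bigD1 (inord i)) //= mxE eqxx -val_eqE /= !inordK // eqSS.
by rewrite big1 ?addr0 // => l /negPf; rewrite mxE => ->.
Qed.

Lemma sl4_root i j : root_index i j -> sl4 (E R i j).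
Proof.
by move=> /and3P[i4 j4 /negPf neq_ij]; rewrite /sl4 /= trace_E // neq_ij.
Qed.

Lemma sl4_cartan i j : root_index i j -> sl4 (E R i i - E R j j).
Proof.
by move=> /and3P[i4 j4 _]; rewrite /sl4 /= linearB /= !trace_E // !eqxx subrr.
Qed.

Context {V : lmodType (C R)} {rho : 'M[C R]_4 -> {linear V -> V}}.
Context (rhoP : lie_representation rho).

Lemma rho0 w : rho 0 w = 0.
Proof.
have sl0 : sl4 (0 : 'M[C R]_4) by rewrite /sl4 /= mxtrace0.
by have := rhoP.1 (-1) 0 0 w sl0 sl0; rewrite scaler0 addr0 scaleN1r addNr.
Qed.

Lemma rhoD X Y w : sl4 X -> sl4 Y -> rho (X + Y) w = rho X w + rho Y w.
Proof. by move=> sX sY; have := rhoP.1 1 X Y w sX sY; rewrite !scale1r. Qed.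

Lemma rhoZ c X w : sl4 X -> rho (c *: X) w = c *: rho X w.
Proof.
move=> sX; have := rhoP.1 c X 0 w sX; rewrite rho0 !addr0; apply.
by rewrite /sl4 /= mxtrace0.
Qed.

Lemma rhoN X w : sl4 X -> rho (- X) w = - rho X w.
Proof. by move=> sX; rewrite -(scaleN1r X) rhoZ // scaleN1r. Qed.

Lemma rho_bracket X Y w : sl4 X -> sl4 Y ->
  rho X (rho Y w) = rho Y (rho X w) + rho (X *m Y - Y *m X) w.
Proof. by move=> sX sY; rewrite rhoP.2 // addrC subrK. Qed.

(** The actions of E_ij and of E_ii - E_jj on [V]. *)
Definition unit_op i j : {linear V -> V} := rho (E R i j).
Definition cartan_op i j : {linear V -> V} := rho (E R i i - E R j j).

Local Notation e := unit_op.
Local Notation h := cartan_op.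

Lemma rho_sl4_relations : sl4_relations e h.
Proof.
split=> i j k l w rij rkl; rewrite /unit_op /cartan_op;
  (rewrite rho_bracket; [|by auto using sl4_root, sl4_cartan..]).
- congr (_ + _); have [/and3P[i4 j4 ij] /and3P[k4 l4 kl]] := (rij, rkl).
  rewrite /bracket_op !mul_E // [l == i]eq_sym.
  case: (eqVneq j k) => [jk|jk]; case: (eqVneq i l) => [il|il].
  + by rewrite jk il.
  + by rewrite subr0.
  + by rewrite sub0r rhoN //; apply: sl4_root; rewrite /root_index k4 j4 eq_sym.
  + by rewrite subr0 rho0.
- rewrite -rhoZ; last exact: sl4_root.
  have [/and3P[i4 j4 ij] /and3P[k4 l4 kl]] := (rij, rkl).
  congr (_ + rho _ w); rewrite mulmxBl mulmxBr !mul_E //.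
  have caseE (a b : nat) (M N : 'M[C R]_4) : (a = b -> M = N) ->
      (if a == b then M else 0) = (a == b)%:R *: N.
    by move=> MN; case: eqP => [/MN->|_]; rewrite ?scale1r ?scale0r.
  rewrite !(caseE _ _ _ (E R k l)); do ?by move=> ->.
  rewrite -!scalerBl [l == i]eq_sym [l == j]eq_sym /root_value.
  by congr (_ *: _); ring.
Qed.

Lemma Y_aE : Y_a R = E R 2 1. Proof. exact: trmx_delta. Qed.
Lemma Y_bE : Y_b R = E R 3 2. Proof. exact: trmx_delta. Qed.
Lemma Y_gE : Y_g R = E R 4 3. Proof. exact: trmx_delta. Qed.
Lemma Y_abE : Y_ab R = E R 3 1. Proof. exact: trmx_delta. Qed.
Lemma Y_bgE : Y_bg R = E R 4 2. Proof. exact: trmx_delta. Qed.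
Lemma Y_abgE : Y_abg R = E R 4 1. Proof. exact: trmx_delta. Qed.

(** On a vector with the indicated eigenvalues of [H_a] and [H_g], the operators
A_delta and B_delta of [rho] are those built from the maps [unit_op]. *)
Section OnWeightVectors.
Context {n m : C R} {w : V}.

(** Stated for multiples of [w], so that [Ha1E] and [Hg1E] can be composed. *)
Lemma Ha1E c : h 1 2 w = n *: w -> Ha1 rho (c *: w) = (c * (n + 1)) *: w.
Proof.
move=> hn; rewrite /Ha1 /= -[rho (H_a R)]/(h 1 2).
by rewrite linearZ /= hn -scalerDr -scalerA scalerDl scale1r.
Qed.

Lemma Hg1E c : h 3 4 w = m *: w -> Hg1 rho (c *: w) = (c * (m + 1)) *: w.
Proof.
move=> hm; rewrite /Hg1 /= -[rho (H_g R)]/(h 3 4).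
by rewrite linearZ /= hm -scalerDr -scalerA scalerDl scale1r.
Qed.

Lemma A_abgE : A_abg rho w = wA_abg e w.
Proof. by []. Qed.

Lemma A_abE : h 3 4 w = m *: w -> A_ab rho w = wA_ab e m w.
Proof.
move=> hm; rewrite -[w in LHS]scale1r /A_ab /= Hg1E // mul1r scale1r.
by rewrite Y_gE linearZ.
Qed.

Lemma A_bgE : h 1 2 w = n *: w -> A_bg rho w = wA_bg e n w.
Proof.
move=> hn; rewrite -[w in LHS]scale1r /A_bg /= Ha1E // mul1r scale1r.
by rewrite Y_aE linearZ.
Qed.

Lemma A_bE : h 1 2 w = n *: w -> h 3 4 w = m *: w ->
  A_b rho w = wA_b e n m w.
Proof.
move=> hn hm; rewrite -[w in LHS]scale1r /A_b /= !(Ha1E, Hg1E) // !mul1r.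
by rewrite !scale1r Y_aE Y_gE !linearZ /= scalerN [(m + 1) * _]mulrC.
Qed.

Lemma B_abE : h 1 2 w = n *: w -> B_ab rho w = wB_ab e n w.
Proof.
move=> hn; rewrite -[w in LHS]scale1r /B_ab /= Ha1E // mul1r scale1r.
by rewrite Y_aE Y_bE Y_abE linearZ.
Qed.

Lemma B_bgE : h 3 4 w = m *: w -> B_bg rho w = wB_bg e m w.
Proof.
move=> hm; rewrite -[w in LHS]scale1r /B_bg /= Hg1E // mul1r scale1r.
by rewrite Y_gE Y_bE Y_bgE linearZ.
Qed.

Lemma B_abgE : h 1 2 w = n *: w -> h 3 4 w = m *: w ->
  B_abg rho w = wB_abg e n m w.
Proof.
move=> hn hm; rewrite -[w in LHS]scale1r /B_abg /= !(Ha1E, Hg1E) // !mul1r.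
rewrite !scale1r Y_aE Y_gE Y_bE Y_abE Y_bgE Y_abgE !linearZ /=.
by rewrite !scalerN [(m + 1) * _]mulrC.
Qed.

Lemma B_bE : B_b rho w = wB_b e w.
Proof. by rewrite /B_b Y_bE. Qed.

End OnWeightVectors.

Lemma rho_h i j l w : root_index i j -> root_index j l ->
  h i l w = h i j w + h j l w.
Proof.
by move=> ij jl; rewrite /cartan_op -rhoD ?addrA ?subrK //; apply: sl4_cartan.
Qed.

Section HighestWeight.
Context {n m : nat} {k : int} {v : V} (hv : K_highest_weight rho n k m v).
Local Notation c := (1 / 2%:R * (k%:~R - n%:R - m%:R) : C R).

Lemma hw_h12 : h 1 2 v = n%:R *: v. Proof. exact: hw_H_a hv. Qed.
Lemma hw_h34 : h 3 4 v = m%:R *: v. Proof. exact: hw_H_g hv. Qed.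

(** [H_0 = H_a + 2 H_b + H_g] determines the eigenvalue of [H_b]. *)
Lemma hw_h23 : h 2 3 v = c *: v.
Proof.
have [sa sb sg] : [/\ sl4 (H_a R), sl4 (H_b R) & sl4 (H_g R)].
  by split; apply: sl4_cartan.
have sD (X Y : 'M[C R]_4) : sl4 X -> sl4 Y -> sl4 (X + Y).
  by rewrite /sl4 /= linearD /= => -> ->; rewrite addr0.
have sb2 : sl4 (2%:R *: H_b R) by rewrite /sl4 /= linearZ /= sb mulr0.
have := hw_H_0 hv; rewrite /H_0 rhoD //; last exact: sD.
rewrite rhoD // rhoZ // (hw_H_a hv) (hw_H_g hv) => eq_k.
have {eq_k} : 2%:R *: rho (H_b R) v = (k%:~R - n%:R - m%:R) *: v.
  by rewrite !scalerBl -eq_k addrAC addrK addrAC subrr add0r.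
move/(congr1 (fun w => (1 / 2%:R) *: w)); rewrite !scalerA => <-.
by rewrite div1r mulVf ?scale1r // pnatr_eq0.
Qed.

Lemma hw_h13 : h 1 3 v = (c + n%:R) *: v.
Proof. by rewrite (rho_h 1 2 3) // hw_h12 hw_h23 -scalerDl addrC. Qed.

Lemma hw_h24 : h 2 4 v = (c + m%:R) *: v.
Proof. by rewrite (rho_h 2 3 4) // hw_h23 hw_h34 -scalerDl. Qed.

Lemma hw_h14 : h 1 4 v = (c + n%:R + m%:R) *: v.
Proof. by rewrite (rho_h 1 3 4) // hw_h13 hw_h34 -scalerDl. Qed.

End HighestWeight.
End Representation.

Theorem proposition12 (R : realType) (V : lmodType (C R))
    (rho act : 'M[C R]_4 -> {linear V -> V})
    (hV : is_gK_module rho act) (hadm : admissible act)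
    (n : nat) (k : int) (m : nat) (v : V)
    (hv : K_highest_weight rho n k m v) :
  [/\ (1 / (n.+2 * m.+2)%N%:R) *: A_b rho (B_b rho v)
      - (1 / (n.+1 * m.+1)%N%:R) *: B_b rho (A_b rho v)
      - (1 / (n.+1 * n.+2 * m.+1)%N%:R) *: B_ab rho (A_ab rho v)
      - (1 / (n.+1 * m.+1 * m.+2)%N%:R) *: B_bg rho (A_bg rho v)
      - (1 / (n.+1 * n.+2 * m.+1 * m.+2)%N%:R) *: B_abg rho (A_abg rho v)
      = (1 / 2%:R * (k%:~R - n%:R - m%:R)) *: v,
      (1 / (n.+1 * m.+2)%N%:R) *: A_ab rho (B_ab rho v)
      - (1 / (n.+2 * m.+1)%N%:R) *: B_ab rho (A_ab rho v)
      + (1 / (n.+1 * n.+2 * m.+2)%N%:R) *: A_b rho (B_b rho v)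
      - (1 / (n.+2 * m.+1 * m.+2)%N%:R) *: B_abg rho (A_abg rho v)
      = (1 / 2%:R * (k%:~R + n%:R - m%:R)) *: v,
      (1 / (n.+2 * m.+1)%N%:R) *: A_bg rho (B_bg rho v)
      - (1 / (n.+1 * m.+2)%N%:R) *: B_bg rho (A_bg rho v)
      + (1 / (n.+2 * m.+1 * m.+2)%N%:R) *: A_b rho (B_b rho v)
      - (1 / (n.+1 * n.+2 * m.+2)%N%:R) *: B_abg rho (A_abg rho v)
      = (1 / 2%:R * (k%:~R - n%:R + m%:R)) *: v
    & (1 / (n.+1 * m.+1)%N%:R) *: A_abg rho (B_abg rho v)
      - (1 / (n.+2 * m.+2)%N%:R) *: B_abg rho (A_abg rho v)
      + (1 / (n.+1 * m.+1 * m.+2)%N%:R) *: A_ab rho (B_ab rho v)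
      + (1 / (n.+1 * n.+2 * m.+1)%N%:R) *: A_bg rho (B_bg rho v)
      + (1 / (n.+1 * n.+2 * m.+1 * m.+2)%N%:R) *: A_b rho (B_b rho v)
      = (1 / 2%:R * (k%:~R + n%:R + m%:R)) *: v ].
Proof.
have rhoP := gK_lie hV; have rel := rho_sl4_relations rhoP.
have [hn hm] := (hw_h12 hv, hw_h34 hv).
(* Eigenvalues of [H_a] (suffix 1) and [H_g] (suffix 2) on the inner vectors. *)
have Aab1 := wA_ab_weight (m := m%:R) rel hn.
have Abg2 := wA_bg_weight (n := n%:R) rel hm.
have [Aabg1 Aabg2] := wA_abg_weight rel hn hm.
have [Bb1 Bb2] := wB_b_weight rel hn hm.
have Bab2 := wB_ab_weight (n := n%:R) rel hm.
have Bbg1 := wB_bg_weight (m := m%:R) rel hn.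
rewrite !A_abgE !B_bE (A_bE hn hm) (A_abE hm) (A_bgE hn).
rewrite (B_abE hn) (B_bgE hm) (B_abgE hn hm).
rewrite (A_bE Bb1 Bb2) (A_abE Bab2) (A_bgE Bbg1).
rewrite (B_abE Aab1) (B_bgE Abg2) (B_abgE Aabg1 Aabg2).
(* [S1] and [S2] are used below only for [n] and [m]: the numeral 2 is itself of
   the form p.+1%:R and p.+2%:R. *)
have S1 p : p.+1%:R = p%:R + 1 :> C R by rewrite -natr1.
have S2 p : p.+2%:R = p%:R + 2 :> C R by rewrite -addn2 natrD.
have n1 p : p%:R + 1 != 0 :> C R by rewrite -S1 pnatr_eq0.
have n2 p : p%:R + 2 != 0 :> C R by rewrite -S2 pnatr_eq0.
rewrite !natrM !(S2 n, S2 m, S1 n, S1 m).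
have := weight_vector_identities rel (hw_X_a hv) (hw_X_g hv)
  (hw_h23 rhoP hv) (hw_h13 rhoP hv) (hw_h24 rhoP hv) (hw_h14 rhoP hv)
  (n1 n) (n2 n) (n1 m) (n2 m).
case=> -> -> -> ->; split; congr (_ *: _); by field.
Qed.
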